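(* Let $\Gamma(t)=(q(t),p(t))$ be a non-degenerate parametrized curve in $M^4$. Then $\Gamma$ is a null curve of $(M^4,[\mathbf g])$ if and only if the pair $(q(t),p(t))$ satisfies the dancing condition: at each moment $t$, the point $q(t)$ is moving towards the turning point $p^*(t)$ of the line $p(t)$, i.e. $p^*(t)$ lies on the tangent line $q^*(t)$ to the curve $q$ at $q(t)$.
   Context: Elements of $\mathbb R^3$ are columns $\mathbf q$, elements of $(\mathbb R^3)^*$ are rows $\mathbf p$, $\mathbf p\mathbf q=p_iq^i$; $(\mathbf v\times\mathbf w)_i=\epsilon_{ijk}v^jw^k$ on $\mathbb R^3$ and $(\mathbf v\times\mathbf w)^i=\epsilon^{ijk}v_jw_k$ on $(\mathbb R^3)^*$. $\mathbb{RP}^2=\mathbb P(\mathbb R^3)$; $\mathbb{RP}^{2*}=\mathbb P((\mathbb R^3)^* )$ is identified with the set of lines of $\mathbb{RP}^2$; $[\mathbf q]\in[\mathbf p]$ iff $\mathbf p\mathbf q=0$. $M^4\subset\mathbb{RP}^2\times\mathbb{RP}^{2*}$ is the set of non-incident pairs. A curve $(q(t),p(t))$ in $M^4$ is non-degenerate if $q'(t)\ne0$ and $p'(t)\ne0$ for all $t$. If $q(t)=[\mathbf q(t)]$ with $q'\neq0$, its tangent line is $q^*(t)=[\mathbf q(t)\times\mathbf q'(t)]\in\mathbb{RP}^{2*}$; if $p(t)=[\mathbf p(t)]$ with $p'\ne0$, its turning point is $p^*(t)=[\mathbf p(t)\times\mathbf p'(t)]\in\mathbb{RP}^2$ (the contact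 point of the moving line with its envelope). Let $Q^5=\{\mathbf p\mathbf q=1\}\subset\mathbb R^3\oplus(\mathbb R^3)^*$ carry the restriction of the flat metric $-2\,d\mathbf p\,d\mathbf q$. The dancing metric $\mathbf g$ is the unique pseudo-riemannian metric on $M^4$ (of signature $(2,2)$) for which $\Pi:Q^5\to M^4$, $(\mathbf q,\mathbf p)\mapsto([\mathbf q],[\mathbf p])$, is a pseudo-riemannian submersion; $[\mathbf g]$ is its conformal class. A curve $\Gamma$ is null if $\mathbf g(\Gamma',\Gamma')=0$. *)

(* Defs.v *)
From HB Require Import structures.
From mathcomp Require Import all_boot all_order all_algebra ring.
From mathcomp Require Import all_classical all_reals all_analysis.

Set Implicit Arguments.
Unset Strict Implicit.
Unset Printing Implicit Defensive.

Import Order.TTheory GRing.Theory Num.Theory.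
Import numFieldNormedType.Exports.

Local Open Scope classical_set_scope.
Local Open Scope ring_scope.

Section Projective.
Variables (K : fieldType) (V : vectType K).

Record projective := Projective {
  line_of :> {vspace V};
  dim_line_of : \dim line_of == 1%N }.

Lemma dim_vline1 (v : V) : v != 0 -> \dim <[v]> == 1%N.
Proof. by move=> v0; rewrite dim_vline v0. Qed.

Definition ppoint (v : V) (v0 : v != 0) : projective :=
  Projective (dim_vline1 v0).

(* The quotient V / l is realised on the complement l^C chosen by vector.v;
   the quotient map V -> V / l is then the projection onto l^C along l. *)
Definition quotv (l : {vspace V}) : vectType K := subvs_of (l^C)%VS.

Definition quot_map (l : {vspace V}) (v : V) : quotv l :=
  vsproj (l^C)%VS (v - projv l v).

(* T_l P(V) = Hom(l, V / l) *)
Definition tangent (l : projective) : vectType K :=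
  'Hom(subvs_of l, quotv l).

(* The differential at q of the projection q |-> [q], for a nonzero q in l:
   it sends v to the linear map l -> V / l with q |-> v mod l. *)
Definition dproj (l : projective) (q v : V) : tangent l :=
  linfun (fun x : subvs_of l => coord [tuple q] ord0 (vsval x) *: quot_map l v).

End Projective.

Section ProjectiveCurves.
Variables (R : realType) (m n : nat).
Implicit Types (c : R -> projective 'M[R]_(m, n)) (t : R).

Definition local_lift c t : set (R -> 'M[R]_(m, n)) :=
  [set Q | (\forall s \near t, <[Q s]>%VS = c s) /\ derivable Q t 1].

(* A curve in P(V) is differentiable at t iff it has, near t, a lift to
   V \ {0} that is differentiable at t. *)
Definition pdifferentiable c t := local_lift c t !=set0.

(* Some lift of c near t.  The velocity, the tangent line and the turning point
   built from it do not depend on the choice: see local_lift_velocity,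
   local_lift_tangent_line and local_lift_turning_point below. *)
Definition curve_lift c t : R -> 'M[R]_(m, n) :=
  xget (fun=> 0) (local_lift c t).

Definition velocity c t : tangent (c t) :=
  dproj (c t) (curve_lift c t t) ('D_1 (curve_lift c t) t).

End ProjectiveCurves.

Section Dancing.
Variable R : realType.

Definition pairing (p : 'rV[R]_3) (q : 'cV[R]_3) : R := (p *m q) 0 0.

(* The Levi-Civita symbol, with indices 0, 1, 2. *)
Definition eps (i j k : 'I_3) : R :=
  (j%:R - i%:R) * (k%:R - i%:R) * (k%:R - j%:R) / 2.

Definition cross_col (v w : 'cV[R]_3) : 'rV[R]_3 :=
  \row_i \sum_(j < 3) \sum_(k < 3) eps i j k * v j 0 * w k 0.

Definition cross_row (v w : 'rV[R]_3) : 'cV[R]_3 :=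
  \col_i \sum_(j < 3) \sum_(k < 3) eps i j k * v 0 j * w 0 k.

Definition RP2 := projective 'cV[R]_3.
Definition RP2_dual := projective 'rV[R]_3.

Definition incident (a : {vspace 'cV[R]_3}) (b : {vspace 'rV[R]_3}) : Prop :=
  forall q p, q \in a -> p \in b -> pairing p q = 0.

Record M4 := MkM4 {
  point_of : RP2;
  dual_of : RP2_dual;
  non_incident : ~ incident point_of dual_of }.

Definition tangentM (m : M4) : vectType R :=
  (tangent (point_of m) * tangent (dual_of m))%type.

Record Q5 := MkQ5 {
  qvec : 'cV[R]_3;
  pvec : 'rV[R]_3;
  pairing_Q5 : pairing pvec qvec = 1 }.

Lemma qvec_neq0 (x : Q5) : qvec x != 0.
Proof.
apply/eqP => q0; have := pairing_Q5 x.
by rewrite /pairing q0 mulmx0 mxE => /esym/eqP; rewrite oner_eq0.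
Qed.

Lemma pvec_neq0 (x : Q5) : pvec x != 0.
Proof.
apply/eqP => p0; have := pairing_Q5 x.
by rewrite /pairing p0 mul0mx mxE => /esym/eqP; rewrite oner_eq0.
Qed.

Lemma Q5_non_incident (x : Q5) :
  ~ incident (ppoint (qvec_neq0 x)) (ppoint (pvec_neq0 x)).
Proof.
move=> /(_ _ _ (memv_line _) (memv_line _)); rewrite pairing_Q5 => /eqP.
by rewrite oner_eq0.
Qed.

Definition Pi (x : Q5) : M4 := MkM4 (@Q5_non_incident x).

(* T_x Q5, the kernel of d(pq) at x, inside R^3 + (R^3)^*. *)
Definition tangentQ (x : Q5) : set ('cV[R]_3 * 'rV[R]_3) :=
  [set X | pairing (pvec x) X.1 + pairing X.2 (qvec x) = 0].

Definition dPi (x : Q5) (X : 'cV[R]_3 * 'rV[R]_3) : tangentM (Pi x) :=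
  (dproj (point_of (Pi x)) (qvec x) X.1, dproj (dual_of (Pi x)) (pvec x) X.2).

(* The polarization of the quadratic form (v, w) |-> - 2 w v. *)
Definition flat (X Y : 'cV[R]_3 * 'rV[R]_3) : R :=
  - (pairing X.2 Y.1 + pairing Y.2 X.1).

Definition vertical (x : Q5) : set ('cV[R]_3 * 'rV[R]_3) :=
  [set X | tangentQ x X /\ dPi x X = 0].

Definition horizontal (x : Q5) : set ('cV[R]_3 * 'rV[R]_3) :=
  [set X | tangentQ x X /\ forall Y, vertical x Y -> flat X Y = 0].

(* No smoothness in the base point is required: the submersion condition
   already determines the dancing metric pointwise. *)
Definition tensor_field := forall m : M4, {biscalar (tangentM m)}.

Definition pseudo_metric (g : tensor_field) : Prop :=
  forall m : M4, (forall u v, g m u v = g m v u) /\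
                 (forall u, (forall v, g m u v = 0) -> u = 0).

(* Pi is a submersion with nondegenerate fibres, and its differential is
   isometric on the horizontal spaces. *)
Definition pseudo_riemannian_submersion (g : tensor_field) : Prop :=
  forall x : Q5,
  [/\ forall u : tangentM (Pi x), exists2 X, tangentQ x X & dPi x X = u,
      forall X, vertical x X -> (forall Y, vertical x Y -> flat X Y = 0) ->
        X = 0
    & forall X Y, horizontal x X -> horizontal x Y ->
        g (Pi x) (dPi x X) (dPi x Y) = flat X Y].

(* Existence and uniqueness: dancing_metric_exists, dancing_metric_unique. *)
Definition dancing_metric (g : tensor_field) : Prop :=
  pseudo_metric g /\ pseudo_riemannian_submersion g.

(* Arbitrary, not necessarily smooth, positive factors are allowed. *)
Definition conformal_class (g : tensor_field) : set tensor_field :=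
  [set h | exists f : M4 -> R, (forall m, 0 < f m) /\
                               forall m u v, h m u v = f m * g m u v].

Section Curves.
Variables (I : set R) (Gamma : R -> M4).

Definition qcurve (t : R) : RP2 := point_of (Gamma t).
Definition pcurve (t : R) : RP2_dual := dual_of (Gamma t).

Definition curve_in_M4 : Prop :=
  forall t, I t -> pdifferentiable qcurve t /\ pdifferentiable pcurve t.

Definition nondegenerate_curve : Prop :=
  forall t, I t -> velocity qcurve t != 0 /\ velocity pcurve t != 0.

Definition velocityM (t : R) : tangentM (Gamma t) :=
  (velocity qcurve t, velocity pcurve t).

Definition null_curve (g : tensor_field) : Prop :=
  forall t, I t -> g (Gamma t) (velocityM t) (velocityM t) = 0.

(* Subspaces rather than elements of RP2_dual and RP2, since the cross product
   may vanish when the velocity does; they are lines through 0 when it does not: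
   see dim_tangent_line and dim_turning_point below. *)
Definition tangent_line (t : R) : {vspace 'rV[R]_3} :=
  <[cross_col (curve_lift qcurve t t) ('D_1 (curve_lift qcurve t) t)]>%VS.

Definition turning_point (t : R) : {vspace 'cV[R]_3} :=
  <[cross_row (curve_lift pcurve t t) ('D_1 (curve_lift pcurve t) t)]>%VS.

Definition dancing_condition : Prop :=
  forall t, I t -> incident (turning_point t) (tangent_line t).

End Curves.
End Dancing.

Section ProjTheory.
Variables (K : fieldType) (V : vectType K).
Implicit Types (l : projective V) (q v w : V).

Lemma proj_mem_line l q : q != 0 -> q \in (l : {vspace V}) ->
  <[q]>%VS = l :> {vspace V}.
Proof.
move=> q0 ql; apply/eqP; rewrite eqEdim; apply/andP; split; first by rewrite -memvE.
by rewrite (eqP (dim_line_of l)) dim_vline q0.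
Qed.

Lemma proj_line_neq0 l q : <[q]>%VS = l :> {vspace V} -> q != 0.
Proof.
move=> e; apply/eqP=> q0; have := dim_line_of l.
by rewrite -e q0 dim_vline eqxx.
Qed.

Lemma quot_map_eq0 (U : {vspace V}) v : (quot_map U v == 0) = (v \in U).
Proof.
rewrite /quot_map; apply/eqP/idP => [e|vU]; last first.
  by rewrite projv_id ?subrr ?linear0.
have := congr1 vsval e; rewrite vsprojK ?memv_projC // linear0 => /eqP.
by rewrite subr_eq0 => /eqP ->; exact: memv_proj.
Qed.

Fact quot_map_linear (U : {vspace V}) : linear (quot_map U).
Proof.
move=> a u v; rewrite /quot_map -linearP; congr (vsproj _ _).
by rewrite linearP /= scalerBr; rewrite opprD addrACA.
Qed.
HB.instance Definition _ (U : {vspace V}) :=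
  GRing.isSemilinear.Build K V (quotv U) _ (quot_map U)
  (GRing.semilinear_linear (@quot_map_linear U)).

Lemma quot_map_val (U : {vspace V}) (x : quotv U) : quot_map U (vsval x) = x.
Proof.
apply/val_inj; rewrite /quot_map /= vsprojK ?memv_projC //.
suff -> : projv U (val x) = 0 by rewrite subr0.
by apply/eqP; rewrite -memv_ker lker_proj subvsP.
Qed.

Lemma dprojE l q v (x : subvs_of l) : dproj l q v x =
  coord [tuple q] ord0 (vsval x) *: quot_map l v.
Proof.
pose f (x : subvs_of l) := coord [tuple q] ord0 (vsval x) *: quot_map l v.
have fl : linear f.
  by move=> a y z; rewrite /f !linearP /= scalerDl scalerA.
pose F : {linear subvs_of l -> quotv l} := HB.pack f
  (GRing.isSemilinear.Build K (subvs_of l) (quotv l) _ f (GRing.semilinear_linear fl)).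
by rewrite /dproj -[LHS]/(linfun F x) lfunE.
Qed.

Lemma coord1 q a : q != 0 -> coord [tuple q] ord0 (a *: q) = a.
Proof.
move=> q0; rewrite linearZ /=.
have := @coord_free _ _ _ [tuple q] ord0 ord0; rewrite seq1_free /= => -> //.
by rewrite mulr1.
Qed.

Lemma dproj_eqP l q (u u' : tangent l) : <[q]>%VS = l :> {vspace V} ->
  u (vsproj l q) = u' (vsproj l q) -> u = u'.
Proof.
move=> ql e; apply/lfunP => x.
have: vsval x \in <[q]>%VS by rewrite ql subvsP.
case/vlineP => k ek; have -> : x = k *: vsproj l q.
  by apply/val_inj; rewrite linearZ /= vsprojK // -ql memv_line.
by rewrite !linearZ /= e.
Qed.

Lemma dproj_q l q v : <[q]>%VS = l :> {vspace V} ->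
  dproj l q v (vsproj l q) = quot_map l v.
Proof.
move=> ql; rewrite dprojE vsprojK -?ql ?memv_line //.
by rewrite -[X in coord _ _ X]scale1r coord1 ?scale1r // (proj_line_neq0 ql).
Qed.

Lemma dproj_eq0 l q v : <[q]>%VS = l :> {vspace V} ->
  (dproj l q v == 0) = (v \in (l : {vspace V})).
Proof.
move=> ql; rewrite -quot_map_eq0 -(dproj_q v ql); apply/eqP/eqP => [->|e].
  by rewrite lfunE.
by apply: (dproj_eqP ql); rewrite e lfunE.
Qed.

Fact dproj_linear l q : linear (dproj l q).
Proof.
by move=> a u v; apply/lfunP => x; rewrite !lfunE /= !lfunE /= !dprojE linearP
   scalerDr !scalerA mulrC.
Qed.
HB.instance Definition _ l q :=
  GRing.isSemilinear.Build K V (tangent l) _ (dproj l q)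
  (GRing.semilinear_linear (@dproj_linear l q)).

Lemma dprojZ l q v a : a != 0 -> <[q]>%VS = l :> {vspace V} ->
  dproj l (a *: q) (a *: v) = dproj l q v.
Proof.
move=> a0 ql; apply: (dproj_eqP ql); rewrite dproj_q // dprojE vsprojK -?ql ?memv_line //.
have e : q = a^-1 *: (a *: q) by rewrite scalerA mulVf // scale1r.
rewrite [X in coord _ _ X]e.
rewrite coord1; last by rewrite scaler_eq0 negb_or a0 (proj_line_neq0 ql).
by rewrite [X in _ *: X = _]linearZ scalerA mulVf // scale1r.
Qed.

Lemma dproj_surj l q (u : tangent l) : <[q]>%VS = l :> {vspace V} ->
  exists v, dproj l q v = u.
Proof.
move=> ql; exists (vsval (u (vsproj l q))); apply: (dproj_eqP ql).
by rewrite dproj_q // quot_map_val.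
Qed.
End ProjTheory.

Section DancingMetric.
Variable R : realType.
Implicit Types (p w : 'rV[R]_3) (q v : 'cV[R]_3).

Lemma pairingE p q : pairing p q = \sum_i p 0 i * q i 0.
Proof. by rewrite /pairing mxE. Qed.
Lemma pairingDl p p' q : pairing (p + p') q = pairing p q + pairing p' q.
Proof. by rewrite /pairing mulmxDl mxE. Qed.
Lemma pairingDr p q q' : pairing p (q + q') = pairing p q + pairing p q'.
Proof. by rewrite /pairing mulmxDr mxE. Qed.
Lemma pairingZl a p q : pairing (a *: p) q = a * pairing p q.
Proof. by rewrite /pairing -scalemxAl mxE. Qed.
Lemma pairingZr a p q : pairing p (a *: q) = a * pairing p q.
Proof. by rewrite /pairing -scalemxAr mxE. Qed.
Lemma pairingNl p q : pairing (- p) q = - pairing p q.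
Proof. by rewrite -scaleN1r pairingZl mulN1r. Qed.
Lemma pairingNr p q : pairing p (- q) = - pairing p q.
Proof. by rewrite -scaleN1r pairingZr mulN1r. Qed.
Definition pairE := (pairingDl, pairingDr, pairingNl, pairingNr,
                     pairingZl, pairingZr).

Lemma vertE (x : Q5 R) X : vertical x X ->
  exists a : R, X = (a *: qvec x, - a *: pvec x).
Proof.
case: X => v w [/= tX e].
have e1 : dproj (point_of (Pi x)) (qvec x) v == 0 by apply/eqP; exact: (congr1 fst e).
have e2 : dproj (dual_of (Pi x)) (pvec x) w == 0 by apply/eqP; exact: (congr1 snd e).
move: e1 e2 tX; rewrite dproj_eq0 // => /vlineP [a ->] .
rewrite dproj_eq0 // => /vlineP [b eb] tX; exists a; congr pair.
move: tX; rewrite /tangentQ /= eb pairingZr pairingZl pairing_Q5 !mulr1 => /eqP.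
by rewrite addrC addr_eq0 => /eqP ->.
Qed.

Lemma vertP (x : Q5 R) a : vertical x (a *: qvec x, - a *: pvec x).
Proof.
split; first by rewrite /tangentQ /= !pairE pairing_Q5 !mulr1 subrr.
by congr pair; apply/eqP; rewrite dproj_eq0 //= memvZ // memv_line.
Qed.

Lemma horP (x : Q5 R) X : horizontal x X <->
  pairing (pvec x) X.1 = 0 /\ pairing X.2 (qvec x) = 0.
Proof.
case: X => v w /=; split.
  case=> /= t /(_ _ (vertP x 1)).
  rewrite /flat /= scale1r scaleN1r pairE.
  rewrite /tangentQ /= in t.
  set A := pairing (pvec x) v in t *; set B := pairing w (qvec x) in t *.
  move=> e.
  have eA : A = 0.
    have := congr2 +%R t e; rewrite addr0 opprB addrACA => h.
    have {}h : 2 * A = 0 by rewrite -[RHS]h; ring.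
    by apply/eqP; move/eqP: h; rewrite mulf_eq0 pnatr_eq0.
  by split => //; rewrite eA add0r in t.
move=> [A B]; split; first by rewrite /tangentQ /= A B addr0.
move=> Y /vertE [a ->]; rewrite /flat /= !pairE A B; ring.
Qed.

Definition horv (x : Q5 R) v := v - pairing (pvec x) v *: qvec x.
Definition horw (x : Q5 R) w := w - pairing w (qvec x) *: pvec x.

Lemma dproj_horv x l v : <[qvec x]>%VS = line_of l ->
  dproj l (qvec x) (horv x v) = dproj l (qvec x) v.
Proof.
move=> e; apply/eqP; rewrite -subr_eq0 -linearB /= dproj_eq0 // /horv.
by rewrite addrAC subrr add0r -scaleNr memvZ // -e memv_line.
Qed.
Lemma dproj_horw x l w : <[pvec x]>%VS = line_of l ->
  dproj l (pvec x) (horw x w) = dproj l (pvec x) w.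
Proof.
move=> e; apply/eqP; rewrite -subr_eq0 -linearB /= dproj_eq0 // /horw.
by rewrite addrAC subrr add0r -scaleNr memvZ // -e memv_line.
Qed.

Lemma hor_horvw x v w : horizontal x (horv x v, horw x w).
Proof.
by apply/horP; rewrite /= /horv /horw !pairE pairing_Q5; split; ring.
Qed.

Lemma proj_eqP (V : vectType R) (l l' : projective V) :
  (l : {vspace V}) = l' -> l = l'.
Proof.
case: l l' => [l hl] [l' hl'] /= e; subst l'; congr Projective.
exact: bool_irrelevance.
Qed.

Lemma Pi_surj (m : M4 R) : exists x : Q5 R, Pi x = m.
Proof.
have vp (V : vectType R) (l : projective V) : <[vpick l]>%VS = l.
  apply: proj_mem_line; rewrite ?memv_pick // vpick0 -dimv_eq0.
  by rewrite (eqP (dim_line_of l)).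
case: m => l d ni.
pose c := pairing (vpick d) (vpick l).
have c0 : c != 0.
  apply/eqP => c0; apply: ni => q p; rewrite -(vp _ l) -(vp _ d) => /vlineP[a ->] /vlineP[b ->].
  by rewrite !pairE -/c c0 !mulr0.
have h : pairing (c^-1 *: vpick d) (vpick l) = 1 by rewrite pairE mulVf.
exists (MkQ5 h).
have e1 : point_of (Pi (MkQ5 h)) = l by apply: proj_eqP; rewrite /= vp.
have e2 : dual_of (Pi (MkQ5 h)) = d.
  apply: proj_eqP; rewrite /= -[RHS]vp.
  apply/eqP; rewrite eqEsubv -!memvE memvZ ?memv_line //=.
  by apply/vlineP; exists c; rewrite scalerA mulfV // scale1r.
move: (Pi _) e1 e2 => [l' d' ni'] /= e1 e2; subst l' d'.
by congr MkM4; exact: Prop_irrelevance.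
Qed.

Section Existence.
Variable m : M4 R.
Definition base_point := sval (cid (Pi_surj m)).
Lemma base_pointP : Pi base_point = m. Proof. exact: svalP (cid (Pi_surj m)). Qed.
Definition lift_col (u : tangentM m) : 'cV[R]_3 :=
  vsval (u.1 (vsproj (point_of m) (qvec base_point))).
Definition lift_row (u : tangentM m) : 'rV[R]_3 :=
  vsval (u.2 (vsproj (dual_of m) (pvec base_point))).
Definition horizontal_form (u u' : tangentM m) : R :=
  flat (horv base_point (lift_col u), horw base_point (lift_row u))
       (horv base_point (lift_col u'), horw base_point (lift_row u')).
Local Notation proj v w := (dproj (point_of m) (qvec base_point) v,
                            dproj (dual_of m) (pvec base_point) w).
Lemma lift_colE a u u' : lift_col (a *: u + u') = a *: lift_col u + lift_col u'.
Proof. by rewrite /lift_col /= add_lfunE scale_lfunE -[RHS]linearP. Qed.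
Lemma lift_rowE a u u' : lift_row (a *: u + u') = a *: lift_row u + lift_row u'.
Proof. by rewrite /lift_row /= add_lfunE scale_lfunE -[RHS]linearP. Qed.
Lemma horizontal_form_bilinear : bilinear_for *%R *%R horizontal_form.
Proof.
split=> u a y z; rewrite /horizontal_form /flat /= /horv /horw.
  by rewrite !lift_colE !lift_rowE !pairE; ring.
by rewrite !lift_colE !lift_rowE !pairE; ring.
Qed.
HB.instance Definition _ := bilinear_isBilinear.Build R _ _ _ *%R *%R
  horizontal_form horizontal_form_bilinear.
Lemma horizontal_form_sym u u' : horizontal_form u u' = horizontal_form u' u.
Proof. by rewrite /horizontal_form /flat addrC. Qed.
Lemma base_colP : <[qvec base_point]>%VS = point_of m. Proof. by rewrite -base_pointP. Qed.
Lemma base_rowP : <[pvec base_point]>%VS = dual_of m. Proof. by rewrite -base_pointP. Qed.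
Lemma horizontal_formE u v w v' w' : u = proj v w ->
  forall u', u' = proj v' w' ->
  horizontal base_point (v, w) -> horizontal base_point (v', w') ->
  horizontal_form u u' = flat (v, w) (v', w').
Proof.
have H : forall u v w, u = proj v w ->
    horizontal base_point (v, w) ->
    horv base_point (lift_col u) = v /\ horw base_point (lift_row u) = w.
  move=> {}u {}v {}w e /horP /= [h1 h2].
  have e1 : dproj (point_of m) (qvec base_point) (lift_col u) =
            dproj (point_of m) (qvec base_point) v.
    apply: (dproj_eqP base_colP).
    by rewrite dproj_q ?base_colP // /lift_col quot_map_val e.
  have e2 : dproj (dual_of m) (pvec base_point) (lift_row u) =
            dproj (dual_of m) (pvec base_point) w.
    apply: (dproj_eqP base_rowP).
    by rewrite dproj_q ?base_rowP // /lift_row quot_map_val e.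
  move/eqP: e1; rewrite -subr_eq0 -linearB dproj_eq0 ?base_colP //.
  rewrite -base_colP => /vlineP [a ea].
  move/eqP: e2; rewrite -subr_eq0 -linearB dproj_eq0 ?base_rowP //.
  rewrite -base_rowP => /vlineP [b eb].
  have -> : lift_col u = v + a *: qvec base_point by rewrite -ea addrC subrK.
  have -> : lift_row u = w + b *: pvec base_point by rewrite -eb addrC subrK.
  rewrite /horv /horw !pairE h1 h2 !pairing_Q5 !add0r !mulr1.
  by rewrite !addrK.
move=> e u' e' hh hh'; rewrite /horizontal_form.
by have [-> ->] := H _ _ _ e hh; have [-> ->] := H _ _ _ e' hh'.
Qed.
End Existence.

Lemma Q5_scale (x y : Q5 R) : Pi x = Pi y -> exists2 a, a != 0 &
  qvec y = a *: qvec x /\ pvec y = a^-1 *: pvec x.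
Proof.
move=> e.
have e1 : <[qvec x]>%VS = <[qvec y]>%VS by have := congr1 (fun m => line_of (point_of m)) e.
have e2 : <[pvec x]>%VS = <[pvec y]>%VS by have := congr1 (fun m => line_of (dual_of m)) e.
have := memv_line (qvec y); rewrite -e1 => /vlineP[a ea].
have := memv_line (pvec y); rewrite -e2 => /vlineP[b eb].
have := pairing_Q5 y; rewrite ea eb !pairE pairing_Q5 mulr1 => ab.
have a0 : a != 0 by apply: contra_eq_neq ab => ->; rewrite mulr0 eq_sym oner_eq0.
by exists a => //; split => //; congr (_ *: _);
  rewrite -[b]mulr1 -(mulfV a0) mulrA ab mul1r.
Qed.

Lemma dancing_metric_exists : exists g : tensor_field R, dancing_metric g.
Proof.
exists (fun m => horizontal_form (m:=m)); split=> [m|x].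
  split=> [u v|u h]; first exact: horizontal_form_sym.
  have [v ev] := dproj_surj u.1 (base_colP m); have [w ew] := dproj_surj u.2 (base_rowP m).
  pose x := base_point m.
  have hx := hor_horvw x v w.
  have eu : u = (dproj (point_of m) (qvec x) (horv x v),
                 dproj (dual_of m) (pvec x) (horw x w)).
    by rewrite dproj_horv ?base_colP // dproj_horw ?base_rowP // ev ew; case: (u).
  have hv : forall v' w', flat (horv x v, horw x w) (horv x v', horw x w') = 0.
    move=> v' w'; rewrite -(horizontal_formE (m:=m) eu erefl hx (hor_horvw x v' w')); exact: h.
  move: (horv x v) (horw x w) hx eu hv => v1 w1 /horP /= [h1 h2] eu hv.
  have Z1 : w1 = 0.
    apply/rowP => i; have := hv (delta_mx i 0) 0.
    rewrite /flat /= /horv /horw !pairE h1 h2.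
    have P0 q : pairing 0 q = 0 by rewrite /pairing mul0mx mxE.
    rewrite !P0 !(mulr0,oppr0,addr0,subr0,mul0r).
    by rewrite /pairing -colE !mxE => /eqP; rewrite oppr_eq0 => /eqP.
  have Z2 : v1 = 0.
    apply/colP => i; have := hv 0 (delta_mx 0 i).
    rewrite /flat /= /horv /horw !pairE h1 h2.
    have P0 p : pairing p 0 = 0 by rewrite /pairing mulmx0 mxE.
    rewrite !P0 !(mulr0,oppr0,addr0,subr0,mul0r,add0r).
    by rewrite /pairing -rowE !mxE => /eqP; rewrite oppr_eq0 => /eqP.
  by rewrite eu Z1 Z2 !linear0.
split.
- move=> u; have [v ev] := dproj_surj (l:=point_of (Pi x)) (q:=qvec x) u.1 erefl.
  have [w ew] := dproj_surj (l:=dual_of (Pi x)) (q:=pvec x) u.2 erefl.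
  exists (horv x v, horw x w); first by case: (hor_horvw x v w).
  by rewrite /dPi /= dproj_horv // dproj_horw // ev ew; case: (u).
- move=> X /vertE [a ->] /(_ _ (vertP x 1)).
  rewrite /flat /= !pairE pairing_Q5 => e.
  have {e} /eqP : 2 * a = 0 by rewrite -[RHS]e; ring.
  by rewrite mulf_eq0 pnatr_eq0 /= => /eqP ->; rewrite oppr0 !scale0r.
move=> [v w] [v' w'] /horP /= [a b] /horP /= [c d].
have [k k0 [e1 e2]] := Q5_scale (esym (base_pointP (Pi x))).
have hz u t : pairing (pvec x) u = 0 -> pairing t (qvec x) = 0 ->
   horizontal (base_point (Pi x)) (k *: u, k^-1 *: t).
  by move=> h1 h2; apply/horP; rewrite /= e1 e2 !pairE h1 h2 !mulr0.
rewrite (horizontal_formE (v := k *: v) (w := k^-1 *: w)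
                          (v' := k *: v') (w' := k^-1 *: w')); last 2 first.
- exact: hz.
- exact: hz.
- by rewrite /flat /= !pairE; field; exact: k0.
- by rewrite /dPi /=; congr pair; rewrite ?e1 ?e2 dprojZ // invr_neq0.
- by rewrite /dPi /=; congr pair; rewrite ?e1 ?e2 dprojZ // invr_neq0.
Qed.

Lemma dancing_metric_unique (g g' : tensor_field R) :
  dancing_metric g -> dancing_metric g' ->
  forall m u1 u2, g m u1 u2 = g' m u1 u2.
Proof.
have lift_hor (x : Q5 R) (u : tangentM (Pi x)) : exists2 X, horizontal x X & dPi x X = u.
  have [v ev] := dproj_surj (l:=point_of (Pi x)) (q:=qvec x) u.1 erefl.
  have [w ew] := dproj_surj (l:=dual_of (Pi x)) (q:=pvec x) u.2 erefl.
  exists (horv x v, horw x w); first exact: hor_horvw.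
  by rewrite /dPi /= dproj_horv // dproj_horw // ev ew; case: (u).
move=> [_ gs] [_ gs'] m; have [x <-] := Pi_surj m => u1 u2.
have [X hX <-] := lift_hor x u1; have [Y hY <-] := lift_hor x u2.
by have [_ _ ->] := gs x => //; have [_ _ ->] := gs' x.
Qed.
End DancingMetric.

Section LiftFacts.
Variables (R : realType) (m n : nat).
Implicit Types (c : R -> projective 'M[R]_(m, n)) (t : R).

Lemma curve_liftP c t :
  pdifferentiable c t -> local_lift c t (curve_lift c t).
Proof. by move=> h; exact: xgetPex. Qed.

Lemma lift_change c t (Q P : R -> 'M[R]_(m, n)) :
  local_lift c t Q -> local_lift c t P ->
  exists a b, [/\ a != 0, P t = a *: Q t
                & 'D_1 P t = a *: 'D_1 Q t + b *: Q t].
Proof.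
move=> [nQ dQ] [nP dP].
have Qt := nbhs_singleton nQ; have Pt := nbhs_singleton nP.
have Q0 := proj_line_neq0 Qt; have P0 := proj_line_neq0 Pt.
have [i [j Qij]] : exists i j, Q t i j != 0.
  apply: contrapT => h; move/eqP: Q0; apply; apply/matrixP => i j; rewrite mxE.
  by apply: contrapT => /eqP h'; apply: h; exists i, j.
have prop s : <[Q s]>%VS = c s -> <[P s]>%VS = c s ->
    exists2 a, a != 0 & P s = a *: Q s.
  move=> eQ eP; have := memv_line (P s); rewrite eP -eQ => /vlineP[a ea].
  exists a => //; apply/eqP => a0; have := proj_line_neq0 eP.
  by rewrite ea a0 scale0r eqxx.
have dE M k l : derivable M t 1 -> derivable (fun s : R => (M s : 'M[R]_(m,n)) k l) t 1.
  by move/derivable_mxP; exact.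
have rel k l : Q t i j * 'D_1 P t k l + P t k l * 'D_1 Q t i j =
               P t i j * 'D_1 Q t k l + Q t k l * 'D_1 P t i j.
  rewrite !derive_mx // !mxE.
  rewrite -[LHS](deriveM (dE _ i j dQ) (dE _ k l dP)).
  rewrite -[RHS](deriveM (dE _ i j dP) (dE _ k l dQ)).
  apply: near_eq_derive; near=> s.
  have [||a _ e] := prop s; [by near: s | by near: s|].
  by rewrite /= !fctE e !mxE; ring.
have [a a0 e] := prop t Qt Pt.
exists a, (('D_1 P t i j - a * 'D_1 Q t i j) / Q t i j); split=> //.
apply/matrixP => k l; apply: (mulfI Qij).
have := rel k l; rewrite e !mxE => r.
rewrite mulrDr [X in _ = _ + X]mulrA [Q t i j * (_ / _)]mulrC mulfVK //.
by apply: (addIr (a * Q t k l * 'D_1 Q t i j)); rewrite r; ring.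
Unshelve. all: by end_near.
Qed.

Lemma local_lift_velocity c t (Q : R -> 'M[R]_(m, n)) :
  local_lift c t Q -> velocity c t = dproj (c t) (Q t) ('D_1 Q t).
Proof.
move=> hQ; have hP := curve_liftP (ex_intro _ Q hQ).
have Qt := nbhs_singleton hQ.1.
have [a [b [a0 e1 e2]]] := lift_change hQ hP.
rewrite /velocity e1 e2.
have -> : b *: Q t = a *: ((a^-1 * b) *: Q t) by rewrite scalerA mulrA mulfV // mul1r.
rewrite -scalerDr dprojZ // linearD /=.
by rewrite [X in _ + X](_ : _ = 0) ?addr0 //; apply/eqP; rewrite dproj_eq0 //
  memvZ // -Qt memv_line.
Qed.
End LiftFacts.

Section CrossFacts.
Variable R : realType.
Implicit Types (p w : 'rV[R]_3) (q v : 'cV[R]_3).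

Lemma cross_col_lin a b q v :
  cross_col (a *: q) (a *: v + b *: q) = (a * a) *: cross_col q v.
Proof.
apply/rowP => i; rewrite !mxE !big_ord_recl !big_ord0 !mxE /eps /bump /=.
by rewrite ?addn0; field.
Qed.
Lemma cross_row_lin a b p w :
  cross_row (a *: p) (a *: w + b *: p) = (a * a) *: cross_row p w.
Proof.
apply/colP => i; rewrite !mxE !big_ord_recl !big_ord0 !mxE /eps /bump /=.
by rewrite ?addn0; field.
Qed.

Lemma cross_rowE p w : cross_row p w = (cross_col p^T w^T)^T.
Proof.
by apply/colP => i; rewrite !mxE; apply: eq_bigr => j _; apply: eq_bigr => k _; rewrite !mxE.
Qed.

Lemma ord3P (P : 'I_3 -> Prop) : P 0 -> P 1 -> P 2 -> forall i, P i.
Proof.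
move=> p0 p1 p2 [[|[|[|i]]] hi] //.
- by rewrite (_ : Ordinal hi = 0) //; apply: val_inj.
- by rewrite (_ : Ordinal hi = 1) //; apply: val_inj.
- by rewrite (_ : Ordinal hi = 2) //; apply: val_inj.
Qed.

Lemma cross_col_eq0 q v : q != 0 -> cross_col q v = 0 -> v \in <[q]>%VS.
Proof.
move=> q0 h.
have H i : \sum_(j < 3) \sum_(k < 3) eps R i j k * q j 0 * v k 0 = 0.
  by have := congr1 (fun M : 'rV[R]_3 => M 0 i) h; rewrite !mxE.
have L1 : lift ord0 ord0 = 1 :> 'I_3 by apply: val_inj.
have L2 : lift ord0 (lift ord0 ord0) = 2 :> 'I_3 by apply: val_inj.
have L0 : ord0 = 0 :> 'I_3 by apply: val_inj.
have rel : forall i j, q i 0 * v j 0 = q j 0 * v i 0.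
  have := H 2; have := H 1; have := H 0.
  rewrite !big_ord_recl !big_ord0 /eps !L2 !L1 !L0.
  have -> : (nat_of_ord (2%R : 'I_3))%:R = 2 :> R by [].
  have -> : (nat_of_ord (1%R : 'I_3))%:R = 1 :> R by [].
  have -> : (nat_of_ord (0%R : 'I_3))%:R = 0 :> R by [].
  move=> H0 H1 H2.
  have E0 : q 1 0 * v 2 0 = q 2 0 * v 1 0.
    by apply/eqP; rewrite -subr_eq0; apply/eqP; rewrite -[RHS]H0; field.
  have E1 : q 2 0 * v 0 0 = q 0 0 * v 2 0.
    by apply/eqP; rewrite -subr_eq0; apply/eqP; rewrite -[RHS]H1; field.
  have E2 : q 0 0 * v 1 0 = q 1 0 * v 0 0.
    by apply/eqP; rewrite -subr_eq0; apply/eqP; rewrite -[RHS]H2; field.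
  by apply: ord3P; apply: ord3P.
have [i qi] : exists i, q i 0 != 0.
  apply: contrapT => nq; move/eqP: q0; apply; apply/colP => i; rewrite mxE.
  by apply: contrapT => /eqP h'; apply: nq; exists i.
apply/vlineP; exists (v i 0 / q i 0); apply/colP => j; rewrite mxE.
by apply: (mulfI qi); rewrite rel mulrA mulrCA mulfV // mulr1 mulrC.
Qed.

Lemma cross_row_eq0 p w : p != 0 -> cross_row p w = 0 -> w \in <[p]>%VS.
Proof.
move=> p0; rewrite cross_rowE => /eqP; rewrite trmx_eq0 => /eqP /cross_col_eq0.
rewrite trmx_eq0 => /(_ p0) /vlineP[a e]; apply/vlineP; exists a.
by apply: trmx_inj; rewrite e linearZ.
Qed.
End CrossFacts.

Section CurveFacts.
Variables (R : realType) (Gamma : R -> M4 R) (t : R).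

Lemma vlineZ (V : vectType R) (a : R) (v : V) : a != 0 -> <[a *: v]>%VS = <[v]>%VS.
Proof.
move=> a0; apply/eqP; rewrite eqEsubv -!memvE memvZ ?memv_line //=.
by apply/vlineP; exists a^-1; rewrite scalerA mulVf // scale1r.
Qed.

Lemma local_lift_tangent_line Q : local_lift (qcurve Gamma) t Q ->
  tangent_line Gamma t = <[cross_col (Q t) ('D_1 Q t)]>%VS.
Proof.
move=> hQ; have hP := curve_liftP (ex_intro _ Q hQ).
have [a [b [a0 e1 e2]]] := lift_change hQ hP.
rewrite /tangent_line e1 e2.
by rewrite cross_col_lin vlineZ // mulf_neq0.
Qed.
Lemma local_lift_turning_point P : local_lift (pcurve Gamma) t P ->
  turning_point Gamma t = <[cross_row (P t) ('D_1 P t)]>%VS.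
Proof.
move=> hQ; have hP := curve_liftP (ex_intro _ P hQ).
have [a [b [a0 e1 e2]]] := lift_change hQ hP.
rewrite /turning_point e1 e2.
by rewrite cross_row_lin vlineZ // mulf_neq0.
Qed.

Lemma dim_tangent_line : pdifferentiable (qcurve Gamma) t ->
  velocity (qcurve Gamma) t != 0 -> \dim (tangent_line Gamma t) = 1%N.
Proof.
move=> /curve_liftP hQ v0; have Qt := nbhs_singleton hQ.1.
rewrite /tangent_line dim_vline; case: eqVneq => //= h; case/negP: v0.
by rewrite /velocity dproj_eq0 // -Qt; exact/cross_col_eq0/h/(proj_line_neq0 Qt).
Qed.

Lemma dim_turning_point : pdifferentiable (pcurve Gamma) t ->
  velocity (pcurve Gamma) t != 0 -> \dim (turning_point Gamma t) = 1%N.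
Proof.
move=> /curve_liftP hP v0; have Pt := nbhs_singleton hP.1.
rewrite /turning_point dim_vline; case: eqVneq => //= h; case/negP: v0.
by rewrite /velocity dproj_eq0 // -Pt; exact/cross_row_eq0/h/(proj_line_neq0 Pt).
Qed.
End CurveFacts.

(* Main.v *)
Require Import Defs.
From mathcomp Require Import all_boot all_order all_algebra ring.
From mathcomp Require Import all_classical all_reals all_analysis.
Import Order.TTheory GRing.Theory Num.Theory.
Import numFieldNormedType.Exports.
Local Open Scope classical_set_scope.
Local Open Scope ring_scope.

(** The dancing metric at [(q, p)] in [Q5] is evaluated on the projection of [(v, w)]
    as [-2 ((p q)(w v) - (p v)(w q))], since [p q = 1] and the horizontal parts
    of [v] and [w] are [v - (p v) q] and [w - (w q) p].  By the Binet-Cauchy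
    identity this is [-2 (q x v) (p x w)], [x] being the cross product, which
    vanishes exactly when the turning point [p x w] lies on the tangent
    line [q x v]. *)

Lemma binet_cauchy {R : realType} (p w : 'rV[R]_3) (q v : 'cV[R]_3) :
  pairing (cross_col q v) (cross_row p w) =
  pairing p q * pairing w v - pairing p v * pairing w q.
Proof.
rewrite !pairingE !big_ord_recl !big_ord0 !mxE !big_ord_recl !big_ord0.
by rewrite /eps /= /bump /=; field.
Qed.

Lemma incident_vline {R : realType} (a : 'cV[R]_3) (b : 'rV[R]_3) :
  incident <[a]>%VS <[b]>%VS <-> pairing b a = 0.
Proof.
split=> [/(_ _ _ (memv_line _) (memv_line _)) //|ba0].
by move=> _ _ /vlineP[k ->] /vlineP[l ->]; rewrite !pairE ba0 !mulr0.
Qed.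

(** Allows representatives of a point of [M4] to be rescaled into [Q5]. *)
Lemma non_incident_pairing {R : realType} {m : M4 R} {q : 'cV[R]_3}
    {p : 'rV[R]_3} :
  <[q]>%VS = point_of m -> <[p]>%VS = dual_of m -> pairing p q != 0.
Proof.
by move=> eq ep; apply/eqP => /incident_vline; rewrite eq ep; exact: non_incident.
Qed.

Lemma Pi_eq {R : realType} {x : Q5 R} {m : M4 R} :
  <[qvec x]>%VS = point_of m -> <[pvec x]>%VS = dual_of m -> Pi x = m.
Proof.
case: m => a b ab /= ea eb.
have {}ea : ppoint (qvec_neq0 x) = a by exact: proj_eqP.
have {}eb : ppoint (pvec_neq0 x) = b by exact: proj_eqP.
by subst a b; congr MkM4; exact: Prop_irrelevance.
Qed.

Lemma dancing_metric_Q5E {R : realType} {g : tensor_field R} (x : Q5 R)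
    (m : M4 R) (v : 'cV[R]_3) (w : 'rV[R]_3) :
  dancing_metric g -> Pi x = m ->
  let u : tangentM m :=
    (dproj (point_of m) (qvec x) v, dproj (dual_of m) (pvec x) w) in
  g m u u = - 2 * pairing (cross_col (qvec x) v) (cross_row (pvec x) w).
Proof.
move=> [_ gsub] <- /=.
have [_ _ isom] := gsub x.
(* The pair [(v, w)] need not be horizontal, but its horizontal part differs from it by multiples of
   [qvec x] and [pvec x], which [dproj] kills. *)
have := isom _ _ (hor_horvw x v w) (hor_horvw x v w).
rewrite /dPi /= dproj_horv // dproj_horw // => ->.
by rewrite binet_cauchy /flat /= /horv /horw !pairE pairing_Q5; ring.
Qed.

(** Rescaling [p] and [w] together by the inverse of [pairing p q] reduces to a point of [Q5];
    [cross_row] is bilinear, hence the square in the denominator. *)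
Lemma dancing_metricE {R : realType} {g : tensor_field R} {m : M4 R}
    {q : 'cV[R]_3} {p : 'rV[R]_3} (v : 'cV[R]_3) (w : 'rV[R]_3) :
  dancing_metric g -> <[q]>%VS = point_of m -> <[p]>%VS = dual_of m ->
  let u : tangentM m := (dproj (point_of m) q v, dproj (dual_of m) p w) in
  g m u u = - 2 / pairing p q ^+ 2 * pairing (cross_col q v) (cross_row p w).
Proof.
move=> dg qm pm; set c := pairing p q => u.
have c0 : c != 0 := non_incident_pairing qm pm.
have pq1 : pairing (c^-1 *: p) q = 1 by rewrite pairE mulVf.
pose x := MkQ5 pq1.
have xm : Pi x = m by apply: Pi_eq; rewrite //= vlineZ // invr_neq0.
(* [dproj] is invariant only when base vector and velocity are scaled alike, so [w] is scaled with
   [p]. *)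
have -> : u = (dproj (point_of m) (qvec x) v,
               dproj (dual_of m) (pvec x) (c^-1 *: w)).
  by congr pair; rewrite dprojZ // invr_neq0.
rewrite dancing_metric_Q5E //= !binet_cauchy !pairE.
by field; exact: c0.
Qed.

Theorem theorem1p5 (R : realType) (g h : tensor_field R)
    (I : set R) (Gamma : R -> M4 R) :
  dancing_metric g -> conformal_class g h ->
  open I -> is_interval I ->
  curve_in_M4 I Gamma -> nondegenerate_curve I Gamma ->
  (null_curve I Gamma h <-> dancing_condition I Gamma).
Proof.
move=> dg [f [f_gt0 hE]] _ _ diffG _.
suff pointwise t : I t ->
    h (Gamma t) (velocityM Gamma t) (velocityM Gamma t) = 0 <->
    incident (turning_point Gamma t) (tangent_line Gamma t).
  by split=> H t It; apply/(pointwise t It); exact: H.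
move=> /diffG [/curve_liftP [/nbhs_singleton qt _] /curve_liftP [/nbhs_singleton pt _]].
(* The velocities are by definition [dproj] of the same lifts that define the tangent line and the
   turning point. *)
rewrite /turning_point /tangent_line incident_vline hE dancing_metricE //.
have pq0 := non_incident_pairing qt pt.
split=> [/eqP|->]; last by rewrite !mulr0.
(* The conformal factor, [- 2] and the inverse square are nonzero, so the pairing of the cross
   products vanishes. *)
rewrite !mulf_eq0 gt_eqF //= invr_eq0 sqrf_eq0 (negPf pq0) oppr_eq0 pnatr_eq0 /=.
by move/eqP.
Qed.
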